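(* For every graph $G$ with $m$ edges and no isolated edge, and for every positive integer $k$, there is a bijection $f:E(G)\to\{k,k+1,\ldots,m+k-1\}$ such that the vertex sums $S_v=\sum_{e\ni v}f(e)$ satisfy $S_v\neq S_w$ for every pair of adjacent vertices $v,w$.
   Context: Graphs are finite and simple. An isolated edge of $G$ is an edge forming a connected component isomorphic to $K_2$. *)

(* Defs.v *)
From mathcomp Require Import all_boot.

Set Implicit Arguments.
Unset Strict Implicit.
Unset Printing Implicit Defensive.

(* A finite simple graph with vertex type T is given by its adjacency
   relation, a symmetric and irreflexive boolean relation e : rel T; an edge
   is the two-element set of its endpoints. *)
Section Graph.

Variables (T : finType) (e : rel T).

Definition simple_graph : Prop := symmetric e /\ irreflexive e.

Definition edges : {set {set T}} :=
  [set A : {set T} | [exists x, exists y, e x y && (A == [set x; y])]].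

Definition component (x : T) : {set T} := [set y | connect e x y].

(* A component whose vertex set is an edge has exactly two vertices, and they
   are adjacent, i.e. it is isomorphic to K_2. *)
Definition isolated_edge (A : {set T}) : Prop :=
  A \in edges /\ exists x : T, component x = A.

Definition vertex_sum (f : {set T} -> nat) (v : T) : nat :=
  \sum_(A in edges | v \in A) f A.

End Graph.

(* f restricts to a bijection from E onto the integer interval {a, ..., b}
   (empty when b < a); the values of f outside E are irrelevant. *)
Definition bij_onto_interval (U : finType) (E : {set U}) (a b : nat)
    (f : U -> nat) : Prop :=
  [/\ forall A, A \in E -> a <= f A <= b,
      {in E &, injective f}
    & forall n, a <= n <= b -> exists2 A, A \in E & f A = n].

(* Main.v *)
Require Import Defs.
From mathcomp Require Import all_boot zify.

(** The statement is proved in a weighted form: each vertex [v] carries a weight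
  [s v], and the sums [s v + S_v] must differ along edges. Give the vertex [x]
  minimising [p v] = [s v] + (sum of the [deg v] smallest labels) its [deg x]
  smallest labels. Every other vertex [w] ends with a sum at least
  [p w >= p x], and equality forces the label sets of [x] and [w] to be nested;
  as they share at most one label, this only happens when [w] is a leaf that
  receives the smallest label. Transfer the labels at [x] to the weights of its
  neighbours, delete [x] and recurse.

  The recursion can only get stuck at star components whose leaves have equal
  weights ([viol]). They are avoided by permuting the labels around [x] when
  every non-leaf vertex has two non-leaf neighbours. A vertex [c] with a single
  non-leaf neighbour and [t] leaves of weight [a] is treated first: if some [t]
  labels sum to [a - s c], put them on the leaves of [c]; the last edge at [c]
  then never makes [c] agree with a leaf. If no [t] labels do, the leaves of
  [c] are never in conflict with [c]. *)

Set Implicit Arguments.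
Unset Strict Implicit.
Unset Printing Implicit Defensive.

(** * Sums of label sets *)

Section LabelSets.

Variables (lab : finType) (ev : lab -> nat).
Hypothesis ev_inj : injective ev.
Implicit Types (F G L P : {set lab}) (i j : lab).

Definition lsum F : nat := \sum_(i in F) ev i.

Lemma lsumU1 i F : i \notin F -> lsum (i |: F) = ev i + lsum F.
Proof. by move=> iF; rewrite /lsum big_setU1. Qed.

Lemma lsumD1 i F : i \in F -> lsum F = ev i + lsum (F :\ i).
Proof. by move=> iF; rewrite /lsum (big_setD1 i). Qed.

Lemma lsum_swap i j F : i \in F -> j \notin F ->
  lsum (j |: F :\ i) + ev i = lsum F + ev j.
Proof.
move=> iF jF; rewrite lsumU1 ?inE ?(negPf jF) ?andbF // (lsumD1 iF).
by rewrite -addnA addnC [_ + ev i]addnC.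
Qed.

Lemma card_swap i j F : i \in F -> j \notin F -> #|j |: F :\ i| = #|F|.
Proof.
by move=> iF jF; rewrite cardsU1 !inE (negPf jF) andbF (cardsD1 i F) iF.
Qed.

Lemma sub_swap i j F L : F \subset L -> j \in L -> j |: F :\ i \subset L.
Proof.
move=> FL jL; rewrite subUset sub1set jL /=.
exact: subset_trans (subsetDl _ _) FL.
Qed.

(** * Choosing label sets of a given size and distributing them *)

Lemma ex_subset_card (U : finType) (A : {set U}) t :
  t <= #|A| -> exists2 B : {set U}, B \subset A & #|B| = t.
Proof.
move=> tA; exists [set x in take t (enum A)].
  by apply/subsetP=> x; rewrite inE => /mem_take; rewrite mem_enum.
rewrite cardsE; have /card_uniqP -> : uniq (take t (enum A)).
  exact/take_uniq/enum_uniq.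
by rewrite size_takel // -cardE.
Qed.

(** Exchanging one label of a [t]-subset for an outside one changes its sum, as [ev] is
    injective. *)
Lemma ex_subset_sum_neq L t q : 0 < t < #|L| ->
  exists F, [/\ F \subset L, #|F| = t & lsum F != q].
Proof.
case/andP=> t0 tL; have [F FL Ft] := ex_subset_card (ltnW tL).
case: (eqVneq (lsum F) q) => [Fq|]; last by exists F.
have /card_gt0P[i iF] : 0 < #|F| by rewrite Ft.
have /card_gt0P[j] : 0 < #|L :\: F|.
  by rewrite cardsD (setIidPr FL) Ft subn_gt0.
rewrite inE => /andP[jF jL]; exists (j |: F :\ i); split.
- exact: sub_swap.
- by rewrite card_swap.
have := lsum_swap iF jF; rewrite Fq => E; apply/eqP => E'.
by move: E jF; rewrite E' => /addnI/ev_inj <-; rewrite iF.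
Qed.

Lemma ex_bij (U : finType) (Y : {set U}) F : #|Y| = #|F| ->
  lab -> exists g : {ffun U -> lab}, {in Y &, injective g} /\ g @: Y = F.
Proof.
move=> YF i0; pose g := [ffun y => nth i0 (enum F) (index y (enum Y))].
have idx y : y \in Y -> index y (enum Y) < size (enum F).
  by move=> yY; rewrite -cardE -YF cardE index_mem mem_enum.
have ginj : {in Y &, injective g}.
  move=> y z yY zY; rewrite !ffunE => /eqP.
  rewrite nth_uniq ?enum_uniq ?idx // => /eqP E.
  by rewrite -[y](nth_index y (s := enum Y)) ?mem_enum // E nth_index ?mem_enum.
exists g; split=> //; apply/eqP; rewrite eqEcard card_in_imset // YF leqnn andbT.
apply/subsetP=> _ /imsetP[y yY ->]; rewrite ffunE -mem_enum.
exact/mem_nth/idx.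
Qed.

Definition swapf (U : finType) (g : {ffun U -> lab}) y z : {ffun U -> lab} :=
  [ffun u => if u == y then g z else if u == z then g y else g u].

Lemma swapf_bij (U : finType) (Y : {set U}) F (g : {ffun U -> lab}) y z :
  y \in Y -> z \in Y -> {in Y &, injective g} -> g @: Y = F ->
  {in Y &, injective (swapf g y z)} /\ swapf g y z @: Y = F.
Proof.
move=> yY zY ginj gF.
have hinj : {in Y &, injective (swapf g y z)}.
  move=> u v uY vY; rewrite !ffunE.
  case: (eqVneq u y) => [->|uy]; case: (eqVneq v y) => [->|vy] //.
  - case: (eqVneq v z) => [->|vz] /ginj E.
      by rewrite E.
    by case/eqP: vz; rewrite E.
  - case: (eqVneq u z) => [->|uz] /ginj E.
      by rewrite E.
    by case/eqP: uz; rewrite E.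
  case: (eqVneq u z) => [->|uz]; case: (eqVneq v z) => [->|vz] // /ginj E.
  - by case/eqP: vy; rewrite E.
  - by case/eqP: uy; rewrite E.
  exact: E.
split=> //; apply/eqP; rewrite eqEcard card_in_imset // -gF card_in_imset //.
rewrite leqnn andbT; apply/subsetP=> _ /imsetP[u uY ->]; rewrite ffunE.
by case: ifP => _; [|case: ifP => _]; apply: imset_f.
Qed.

(** Take a bijection with the fewest vertices hitting [S]. If [y] hits it, exchange its label with
    that of some [z] of another weight: [y] is repaired and [z] cannot hit [S], so the count
    drops. *)
Lemma ex_bij_avoid (U : finType) (Y : {set U}) F (s : U -> nat) S y1 y2 :
  #|Y| = #|F| -> y1 \in Y -> y2 \in Y -> s y1 != s y2 ->
  exists g : {ffun U -> lab}, [/\ {in Y &, injective g}, g @: Y = F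
    & forall y, y \in Y -> s y + ev (g y) != S].
Proof.
move=> YF y1Y y2Y s12.
pose P (g : {ffun U -> lab}) := dinjectiveb g Y && (g @: Y == F).
pose bad (g : {ffun U -> lab}) := [set y in Y | s y + ev (g y) == S].
have [i0 _] : exists i, i \in F by apply/card_gt0P; rewrite -YF; apply/card_gt0P; exists y1.
have [g0 [g0inj g0F]] := ex_bij YF i0.
have Pg0 : P g0 by apply/andP; split; [exact/dinjectiveP | exact/eqP].
case: (arg_minnP (fun g => #|bad g|) Pg0) => g /andP[/dinjectiveP ginj /eqP gF] gmin.
exists g; split=> // y yY; apply: contraT => /negPn/eqP yS.
have [z zY syz] : exists2 z, z \in Y & s z != s y.
  by case: (eqVneq (s y1) (s y)) => [E|]; [exists y2; rewrite -?E 1?eq_sym | exists y1].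
have yz : y != z by apply: contraNneq syz => ->.
have [hinj hF] := swapf_bij yY zY ginj gF.
have /gmin : P (swapf g y z).
  by apply/andP; split; [exact/dinjectiveP | exact/eqP].
rewrite leqNgt => /negP[]; apply: proper_card; apply/properP; split.
  apply/subsetP=> u; rewrite !inE ffunE => /andP[uY].
  case: (eqVneq u y) => [->|uy].
    rewrite -yS eqn_add2l => /eqP/ev_inj/ginj E.
    by move: yz; rewrite E // eqxx.
  case: (eqVneq u z) => [->|uz]; last by rewrite uY.
  by rewrite -yS eqn_add2r (negPf syz).
exists y; rewrite !inE ?yY ?yS ?eqxx // ffunE eqxx -yS eqn_add2l /=.
by apply/eqP=> /ev_inj/ginj E; move: yz; rewrite E // eqxx.
Qed.

Lemma lsum_imset (U : finType) (Y : {set U}) (g : U -> lab) F :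
  {in Y &, injective g} -> g @: Y = F -> \sum_(y in Y) ev (g y) = lsum F.
Proof. by move=> ginj <-; rewrite /lsum big_imset. Qed.

(** * Label sets of minimum sum *)

(** For injective [ev], [F] consists of the [#|F|] smallest labels of [L]; the minimal-sum form
    directly bounds vertex sums from below. *)
Definition lowset L F :=
  (F \subset L) && [forall G : {set lab},
    (G \subset L) && (#|G| == #|F|) ==> (lsum F <= lsum G)].

Lemma lowset_sub L F : lowset L F -> F \subset L.
Proof. by case/andP. Qed.

Lemma lowset_le L F G : lowset L F -> G \subset L -> #|G| = #|F| ->
  lsum F <= lsum G.
Proof.
by case/andP=> _ /forallP/(_ G)/implyP H GL GF; apply: H; rewrite GL GF eqxx.
Qed.

Lemma lowset_eq L F G : lowset L F -> G \subset L -> #|G| = #|F| ->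
  lsum G = lsum F -> lowset L G.
Proof.
move=> Flow GL GF E; rewrite /lowset GL; apply/forallP=> K; apply/implyP.
by case/andP=> KL /eqP KG; rewrite E (lowset_le Flow) // KG.
Qed.

Lemma ex_lowset L d : d <= #|L| -> exists2 F, lowset L F & #|F| = d.
Proof.
move=> dL; have [F0 F0L F0d] := ex_subset_card dL.
pose P F := (F \subset L) && (#|F| == d).
have PF0 : P F0 by rewrite /P F0L F0d eqxx.
case: (arg_minnP lsum PF0) => F /andP[FL /eqP Fd] Fmin.
by exists F => //; rewrite /lowset FL Fd; apply/forallP=> G; apply/implyP/Fmin.
Qed.

(** Exchange argument: for [i] in [F] only and [j] in [G] only, minimality of both sets gives
    [ev i = ev j]. *)
Lemma lowset_nested L F G : lowset L F -> lowset L G -> #|F| <= #|G| ->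
  F \subset G.
Proof.
move=> Flow Glow FG; apply/subsetP=> i iF; apply: contraT => iG.
have FL := lowset_sub Flow; have GL := lowset_sub Glow.
have [j jG jF] : exists2 j, j \in G & j \notin F.
  have /subsetPn[j jG jF] : ~~ (G \subset F).
    apply/negP=> sGF; have /eqP E : G == F by rewrite eqEcard sGF.
    by move: iG; rewrite E iF.
  by exists j.
have HF := lowset_le Flow (sub_swap i FL (subsetP GL _ jG)) (card_swap iF jF).
have HG := lowset_le Glow (sub_swap j GL (subsetP FL _ iF)) (card_swap jG iG).
have := lsum_swap iF jF; have := lsum_swap jG iG => E1 E2.
have ij : ev i = ev j by lia.
by move: jF; rewrite -(ev_inj ij) iF.
Qed.

(** * Splitting labels over a double star *)

(* Labels for two adjacent centres of weights [sc] and [sx], all of whose other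
   neighbours are leaves of weight [a]: [F] and [P] go to the leaves, [b] to the
   edge between the centres. *)
Definition double_star_split L t p sc sx a F P (b : lab) :=
  [/\ [/\ F \subset L, P \subset L & b \in L],
      [/\ {in F, forall i, i \notin P}, b \notin F & b \notin P],
      #|F| = t /\ #|P| = p,
      {in F, forall i, sc + lsum F + ev b != a + ev i} /\
      {in P, forall i, sx + lsum P + ev b != a + ev i}
    & sc + lsum F != sx + lsum P].

Lemma double_star_splitC L t p sc sx a F P b :
  double_star_split L t p sc sx a F P b ->
  double_star_split L p t sx sc a P F b.
Proof.
case=> [[FL PL bL] [FP bF bP] [Ft Pp] [HF HP] H]; split=> //.
- by split=> // i iP; apply/negP=> /FP; rewrite iP.
- by rewrite eq_sym.
Qed.

(** Any [b] in [G] can be the middle label: the first centre ends at [a + ev b] with [b] outside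
    [F], and the condition on [G], read at [b], also keeps the two centres apart. *)
Lemma double_star_split_easy L sc sx a F G :
  F \subset L -> G \subset L -> {in F, forall i, i \notin G} -> 0 < #|G| ->
  sc + lsum F = a -> {in G, forall i, sx + lsum G != a + ev i} ->
  exists P b, double_star_split L #|F| #|G|.-1 sc sx a F P b.
Proof.
move=> FL GL FG /card_gt0P[b bG] scF sxG; exists (G :\ b), b.
have bF : b \notin F by apply/negP=> /FG; rewrite bG.
have Gb := lsumD1 bG.
split.
- by split=> //; [exact: subset_trans (subsetDl _ _) GL | exact: (subsetP GL)].
- split=> //; last by rewrite !inE eqxx.
  by move=> i /FG iG; rewrite inE (negPf iG) andbF.
- by rewrite (cardsD1 b G) bG.
- split=> i.
    rewrite scF eqn_add2l => iF; apply: contraNneq bF => E.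
    by rewrite (ev_inj E).
  rewrite inE => /andP[_ /sxG]; by rewrite -addnA [_ + ev b]addnC -Gb.
by have := sxG b bG; rewrite scF Gb; lia.
Qed.

(** If the easy criterion fails, [G] is [b |: P] where [P] lifts the second centre to exactly [a].
    Exchanging a label of [F] with one of [P] then works, unless it ties a centre with a leaf; such
    a tie is an additive relation that leads back to the easy criterion. *)
Lemma ex_double_star_split L sc sx a F G :
  F \subset L -> G \subset L -> {in F, forall i, i \notin G} ->
  0 < #|F| -> 1 < #|G| -> sc + lsum F = a ->
  exists F' P b, double_star_split L #|F| #|G|.-1 sc sx a F' P b.
Proof.
move=> FL GL FG F0 G1 scF.
case: (boolP [exists b in G, sx + lsum G == a + ev b]); last first.
  rewrite negb_exists_in => /forall_inP H.
  by exists F; apply: double_star_split_easy => //; exact: ltnW.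
case/exists_inP=> b bG /eqP Gb.
pose P := G :\ b; have GbP : lsum G = ev b + lsum P := lsumD1 bG.
have sxP : sx + lsum P = a by move: Gb; rewrite GbP; clear; lia.
have cP : #|G| = #|P|.+1 by rewrite (cardsD1 b G) bG.
rewrite cP /=; have bP : b \notin P by rewrite !inE eqxx.
have bF : b \notin F by apply/negP=> /FG; rewrite bG.
have bL : b \in L by apply: (subsetP GL).
have PL : P \subset L by apply: subset_trans (subsetDl _ _) GL.
have FP : {in F, forall i, i \notin P} by move=> i /FG H; rewrite inE (negPf H) andbF.
have PF : {in P, forall i, i \notin F} by move=> i iP; apply/negP=> /FP; rewrite iP.
have P0 : 0 < #|P| by move: G1; rewrite cP.
clearbody P.
(* A relation g + b = f + f' yields another subset of the same size and sum as
   F, whose complement omits b and hence has no subset summing as P does. *)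
have aux sc' sx' F1 P1 f f' g : F1 \subset L -> P1 \subset L ->
    {in F1, forall i, i \notin P1} -> b \notin F1 -> b \notin P1 ->
    sc' + lsum F1 = a -> sx' + lsum P1 = a ->
    f \in F1 -> f' \in F1 -> f' != f -> g \in P1 -> ev g + ev b = ev f + ev f' ->
    exists F2 P2 b2, double_star_split L #|F1| #|P1| sc' sx' a F2 P2 b2.
  move=> F1L P1L FP1 bF1 bP1 scF1 sxP1 fF f'F f'f gP E.
  have gF : g \notin F1 by apply/negP=> /FP1; rewrite gP.
  have fP := FP1 _ fF; have f'P := FP1 _ f'F.
  have gb : g != b by apply: contraNneq bP1 => <-.
  have fb : f != b by apply: contraNneq bF1 => <-.
  have f'b : f' != b by apply: contraNneq bF1 => <-.
  have f'g : f' != g by apply: contraNneq gF => <-.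
  have fg : f != g by apply: contraNneq gF => <-.
  pose F1' := g |: F1 :\ f; pose F2 := b |: F1' :\ f'.
  pose P1' := f |: P1 :\ g; pose G2 := f' |: P1'.
  have f'F1 : f' \in F1' by rewrite !inE f'F f'f orbT.
  have bF1' : b \notin F1' by rewrite !inE (negPf bF1) andbF orbF eq_sym.
  have f'P1 : f' \notin P1' by rewrite !inE (negPf f'P) andbF orbF.
  have cF2 : #|F2| = #|F1| by rewrite !card_swap.
  have cG2 : #|G2| = #|P1|.+1 by rewrite cardsU1 f'P1 card_swap.
  have eF2 : lsum F2 = lsum F1.
    have := lsum_swap f'F1 bF1'; have := lsum_swap fF gF; rewrite -/F1' -/F2.
    by move: (lsum F1) (lsum F1') (lsum F2) E => A B C; clear; lia.
  have eG2 : lsum G2 = lsum P1 + ev b.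
    have := lsumU1 f'P1; have := lsum_swap gP fP; rewrite -/P1' -/G2.
    by move: (lsum P1) (lsum P1') (lsum G2) E => A B C; clear; lia.
  exists F2; rewrite -cF2 (_ : #|P1| = #|G2|.-1); last by rewrite cG2.
  apply: double_star_split_easy.
  - by apply: sub_swap => //; apply: sub_swap => //; apply: (subsetP P1L).
  - rewrite subUset sub1set (subsetP F1L) //=.
    by apply: sub_swap => //; apply: (subsetP F1L).
  - move=> i; rewrite !inE => /orP[/eqP->|].
      by rewrite !(eq_sym b) (negPf f'b) (negPf fb) (negPf bP1) andbF.
    case/andP=> if' /orP[/eqP->|/andP[if_ /FP1 iP]].
      by rewrite !(eq_sym g) (negPf f'g) (negPf fg) eqxx.
    by rewrite (negPf if') (negPf if_) (negPf iP) andbF.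
  - by rewrite cG2.
  - by rewrite eF2.
  move=> i iG; apply/eqP => Ei.
  move: iG; rewrite (_ : i = b); last first.
    by apply/ev_inj/(@addnI a); rewrite -Ei eG2 addnA sxP1.
  rewrite !inE !(eq_sym b) (negPf f'b) (negPf fb) (negPf bP1).
  by rewrite andbF.
have /card_gt0P[f fF] := F0; have /card_gt0P[g gP] := P0.
have fP := FP _ fF; have gF := PF _ gP.
have gb : g != b by apply: contraNneq bP => <-.
have fb : f != b by apply: contraNneq bF => <-.
have fg : f != g by apply: contraNneq gF => <-.
case: (boolP [exists f' in F, (f' != f) && (ev g + ev b == ev f + ev f')]).
  by case/exists_inP=> f' f'F /andP[f'f /eqP E]; apply: aux E.
rewrite negb_exists_in => /forall_inP HF.
case: (boolP [exists g' in P, (g' != g) && (ev f + ev b == ev g + ev g')]).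
  case/exists_inP=> g' g'P /andP[g'g /eqP E].
  have [P2 [F2 [b2 /double_star_splitC ?]]] :
    exists P2 F2 b2, double_star_split L #|P| #|F| sx sc a P2 F2 b2 by apply: aux E.
  by exists F2, P2, b2.
rewrite negb_exists_in => /forall_inP HP.
(* With both relations excluded, exchange [f] and [g]: the centres move from [a] by opposite nonzero
   amounts, so they differ. *)
have eF := lsum_swap fF gF; have eP := lsum_swap gP fP.
exists (g |: F :\ f), (f |: P :\ g), b; rewrite /double_star_split.
move: (lsum (g |: F :\ f)) (lsum (f |: P :\ g)) eF eP => A B eF eP; split.
- by split=> //; apply: sub_swap => //; [exact: (subsetP PL) | exact: (subsetP FL)].
- split.
  + move=> i; rewrite !inE => /orP[/eqP->|/andP[if_ /FP iP]].
      by rewrite eq_sym (negPf fg) eqxx.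
    by rewrite (negPf if_) (negPf iP) andbF.
  + by rewrite !inE eq_sym (negPf gb) (negPf bF) andbF.
  + by rewrite !inE eq_sym (negPf fb) (negPf bP) andbF.
- by rewrite !card_swap.
- split=> i; rewrite !inE => /orP[/eqP->|/andP[if_ iS]]; apply/eqP=> E.
  + by case/eqP: fb; apply: ev_inj; move: E eF scF; clear; lia.
  + by have := HF _ iS; rewrite if_ /= => /eqP[]; move: E eF scF; clear; lia.
  + by case/eqP: gb; apply: ev_inj; move: E eP sxP; clear; lia.
  + by have := HP _ iS; rewrite if_ /= => /eqP[]; move: E eP sxP; clear; lia.
apply/eqP=> E; case/eqP: fg; apply: ev_inj.
by move: E eF eP scF sxP; clear; lia.
Qed.

End LabelSets.

(** * Weighted labellings *)

Section Weighted.

Variables (T lab : finType) (ev : lab -> nat) (i0 : lab).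
Hypothesis ev_inj : injective ev.
Implicit Types (E : {set {set T}}) (Y : {set T}) (c u v w x y : T).
Implicit Types (L F : {set lab}) (s : T -> nat) (f : {set T} -> lab).

Local Notation lsum := (lsum ev).

Definition pairs E := {in E, forall A : {set T}, #|A| = 2}.
Definition adj E u v := (u != v) && ([set u; v] \in E).
Definition nbh E v := [set u | adj E v u].
Definition deg E v := #|nbh E v|.
Definition star c Y : {set {set T}} := [set [set c; y] | y in Y].
Definition del E c Y := E :\: star c Y.

Definition wsum E s f v := s v + \sum_(u in nbh E v) ev (f [set v; u]).
Definition labelling E L f := {in E &, injective f} /\ {in E, forall A, f A \in L}.
Definition separating E s f := forall u v, adj E u v -> wsum E s f u != wsum E s f v.
Definition good E s L := exists2 f, labelling E L f & separating E s f.

(** Weights once the edges from [c] to [Y] are labelled by [g] and deleted: both ends of each edge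
    keep its label as weight, so sums are preserved. *)
Definition raise s c Y (g : T -> lab) v :=
  s v + (if v == c then \sum_(y in Y) ev (g y)
         else if v \in Y then ev (g v) else 0).

(** * Neighbourhoods, deletion of stars and extension of labellings *)

Lemma adjC E u v : adj E u v = adj E v u.
Proof. by rewrite /adj eq_sym setUC. Qed.

Lemma in_nbh E u v : (u \in nbh E v) = adj E v u.
Proof. by rewrite inE. Qed.

Lemma nbhC E u v : (u \in nbh E v) = (v \in nbh E u).
Proof. by rewrite !inE adjC. Qed.

Lemma nbh_neq E u v : u \in nbh E v -> u != v.
Proof. by rewrite in_nbh eq_sym => /andP[]. Qed.

Lemma set2_inj v u w : v != u -> [set v; u] = [set v; w] -> u = w.
Proof.
by move=> vu /setP/(_ u); rewrite !inE eqxx orbT eq_sym (negPf vu) => /esym/eqP.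
Qed.

Lemma set2_eq u v c y : u != v -> [set u; v] = [set c; y] ->
  (u = c /\ v = y) \/ (u = y /\ v = c).
Proof.
move=> uv E; have /setP/(_ u) := E; rewrite !inE eqxx /= => /esym/orP[/eqP uc|/eqP uy].
  by left; split=> //; subst c; apply: set2_inj uv E.
right; split=> //; subst y; rewrite [[set c; u]]setUC in E.
exact: set2_inj uv E.
Qed.

Lemma nbh_set2_inj E v : {in nbh E v &, injective (fun u => [set v; u])}.
Proof. by move=> u w /nbh_neq uv _; apply: set2_inj; rewrite eq_sym. Qed.

Lemma incident_nbh E v : pairs E ->
  [set A in E | v \in A] = [set [set v; u] | u in nbh E v].
Proof.
move=> Epairs; apply/setP=> A; rewrite inE; apply/idP/imsetP.
  case/andP=> AE; have /eqP/cards2P[x [y [xy EA]]] := Epairs A AE.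
  rewrite EA !inE => /orP[] /eqP ->.
    by exists y => //; rewrite in_nbh /adj xy -EA.
  by exists x; [rewrite in_nbh /adj eq_sym xy setUC -EA | rewrite setUC].
by case=> u; rewrite in_nbh => /andP[_ ?] ->; rewrite !inE eqxx andbT.
Qed.

Lemma sum_incident E (h : {set T} -> nat) v : pairs E ->
  \sum_(A in E | v \in A) h A = \sum_(u in nbh E v) h [set v; u].
Proof.
move=> Epairs; rewrite -(big_imset h (@nbh_set2_inj E v)) -incident_nbh //.
by apply: eq_bigl => A; rewrite inE.
Qed.

Lemma adj_del E c Y u v : Y \subset nbh E c -> adj (del E c Y) u v =
  adj E u v && ~~ ((u == c) && (v \in Y) || (v == c) && (u \in Y)).
Proof.
move=> YN; rewrite /adj /del inE; case: (eqVneq u v) => //= uv.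
rewrite andbC; congr (_ && ~~ _); apply/imsetP/idP.
  case=> y yY /(set2_eq uv)[] [-> ->]; by rewrite eqxx yY ?orbT.
case/orP=> /andP[/eqP-> ?]; first by exists v.
by exists u; rewrite // setUC.
Qed.

Lemma nbh_del_center E c Y : Y \subset nbh E c ->
  nbh (del E c Y) c = nbh E c :\: Y.
Proof.
move=> YN; apply/setP=> u; rewrite inE adj_del // !inE eqxx /= andbC.
case: (eqVneq u c) => [->|]; last by rewrite orbF.
by rewrite /adj eqxx !andbF.
Qed.

Lemma nbh_del_leaf E c Y y : Y \subset nbh E c -> y \in Y ->
  nbh (del E c Y) y = nbh E y :\ c.
Proof.
move=> YN yY; apply/setP=> u; rewrite inE adj_del // !inE yY andbT /=.
by rewrite (negPf (nbh_neq (subsetP YN _ yY))) /= andbC.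
Qed.

Lemma nbh_del_other E c Y v : Y \subset nbh E c -> v != c -> v \notin Y ->
  nbh (del E c Y) v = nbh E v.
Proof.
move=> YN vc vY; apply/setP=> u; rewrite inE adj_del // !inE (negPf vc) (negPf vY).
by rewrite andbF andbT.
Qed.

Lemma pairs_del E c Y : pairs E -> pairs (del E c Y).
Proof. by move=> H A /setDP[/H]. Qed.

Lemma star_sub E c Y : Y \subset nbh E c -> star c Y \subset E.
Proof.
move=> YN; apply/subsetP=> _ /imsetP[y yY ->].
by have := subsetP YN _ yY; rewrite in_nbh => /andP[].
Qed.

Lemma card_del E c Y : Y \subset nbh E c -> #|E| = #|del E c Y| + #|Y|.
Proof.
move=> YN; have <- : #|star c Y| = #|Y|.
  apply: card_in_imset => u v /(subsetP YN) uN /(subsetP YN) vN.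
  exact: (nbh_set2_inj uN vN).
by rewrite addnC -{1}(setIidPr (star_sub YN)) cardsID.
Qed.

Lemma adj_delP E c Y u v : Y \subset nbh E c -> adj E u v ->
  [\/ adj (del E c Y) u v, u = c /\ v \in Y | v = c /\ u \in Y].
Proof.
move=> YN uv; rewrite adj_del // uv /=.
case: (boolP (_ || _)); last by constructor 1.
by case/orP=> /andP[/eqP -> H]; [constructor 2 | constructor 3].
Qed.

Lemma ex_star_extension E c Y g F L f : Y \subset nbh E c ->
  {in Y &, injective g} -> g @: Y = F -> F \subset L ->
  labelling (del E c Y) (L :\: F) f ->
  exists f1, [/\ labelling E L f1, {in Y, forall y, f1 [set c; y] = g y}
    & forall s v, wsum E s f1 v = wsum (del E c Y) (raise s c Y g) f v].
Proof.
move=> YN ginj gF FL [finj fL].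
pose f1 A := if [pick y in Y | A == [set c; y]] is Some y then g y else f A.
have f1Y y : y \in Y -> f1 [set c; y] = g y.
  move=> yY; rewrite /f1; case: pickP => [z /andP[zY /eqP E']|/(_ y)].
    by rewrite (nbh_set2_inj (subsetP YN _ yY) (subsetP YN _ zY) E').
  by rewrite yY eqxx.
have f1del A : A \in del E c Y -> f1 A = f A.
  rewrite inE => /andP[AS _]; rewrite /f1; case: pickP => // y /andP[yY /eqP EA].
  by case/negP: AS; rewrite EA; apply: imset_f.
have split_E A : A \in E -> A \in del E c Y \/ exists2 y, y \in Y & A = [set c; y].
  move=> AE; case: (boolP (A \in star c Y)) => [/imsetP|AS]; first by right.
  by left; rewrite inE AS.
have gin y : y \in Y -> g y \in F by move=> yY; rewrite -gF imset_f.
exists f1; split=> //; first split.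
- move=> A B /split_E[AE|[y yY ->]] /split_E[BE|[z zY ->]].
  + by rewrite !f1del //; apply: finj.
  + by rewrite (f1del A) // f1Y // => H; have := fL A AE; rewrite H inE gin.
  + by rewrite (f1del B) // f1Y // => H; have := fL B BE; rewrite -H inE gin.
  + by rewrite !f1Y // => /(ginj _ _ yY zY) ->.
- move=> A /split_E[AE|[y yY ->]]; last by rewrite f1Y // (subsetP FL) ?gin.
  by rewrite f1del //; have := fL A AE; rewrite inE => /andP[].
move=> s v; rewrite /wsum /raise -addnA; congr (_ + _).
have f1sum w (W : {set T}) : W = nbh (del E c Y) w ->
    \sum_(u in W) ev (f1 [set w; u]) = \sum_(u in W) ev (f [set w; u]).
  move=> ->; apply: eq_bigr => u; rewrite in_nbh => /andP[_ uE].
  by rewrite f1del.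
case: (eqVneq v c) => [->|vc].
  rewrite (big_setID Y) /= (setIidPr YN) nbh_del_center //; congr (_ + _).
    by apply: eq_bigr => y yY; rewrite f1Y.
  by rewrite f1sum // nbh_del_center.
case: (boolP (v \in Y)) => vY; last first.
  by rewrite nbh_del_other // f1sum ?nbh_del_other.
rewrite nbh_del_leaf // (big_setD1 c) /=; last by rewrite nbhC (subsetP YN).
by rewrite setUC f1Y // f1sum // nbh_del_leaf.
Qed.

Lemma wsum_labels E L s f v : labelling E L f ->
  let F := [set f [set v; u] | u in nbh E v] in
  [/\ F \subset L, #|F| = deg E v & wsum E s f v = s v + lsum F].
Proof.
move=> [finj fL] F.
have inE' u : u \in nbh E v -> [set v; u] \in E by rewrite in_nbh => /andP[].
have hinj : {in nbh E v &, injective (fun u => f [set v; u])}.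
  move=> u w uN wN H; apply: (nbh_set2_inj uN wN).
  exact: finj (inE' _ uN) (inE' _ wN) H.
split.
- by apply/subsetP=> _ /imsetP[u uN ->]; apply/fL/inE'.
- exact: card_in_imset.
- by congr (_ + _); rewrite /lsum big_imset.
Qed.

(** * Violations at star components *)

(* [v] is the centre of a star component whose labels may force a tie
   between [v] and a leaf; with two leaves or more, a leaf of weight at most [s v]
   always ends below the centre, since labels are positive. *)
Definition viol E s v := [&& 0 < deg E v,
  [forall u in nbh E v, deg E u == 1],
  [forall u in nbh E v, if deg E v == 1 then s u == s v else s v < s u]
  & [forall u in nbh E v, forall w in nbh E v, s u == s w]].

Lemma viol_eq E E' s s' v : nbh E' v = nbh E v ->
  {in nbh E v, forall u, deg E' u = deg E u} -> s' v = s v ->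
  {in nbh E v, s' =1 s} -> viol E' s' v = viol E s v.
Proof.
move=> EN Edeg Esv Es; rewrite /viol /deg EN; congr [&& _, _, _ & _].
- by apply: eq_forallb_in => u uN; congr (_ == _); exact: Edeg.
- by apply: eq_forallb_in => u uN; rewrite Esv Es.
apply: eq_forallb_in => u uN; apply: eq_forallb_in => w wN.
by rewrite !Es.
Qed.

Lemma deg1_nbh E u v : deg E u = 1 -> v \in nbh E u -> nbh E u = [set v].
Proof. by move/eqP/cards1P=> [w ->]; rewrite inE => /eqP ->. Qed.

Lemma nbh_del_leaf0 E c Y y : Y \subset nbh E c -> y \in Y -> deg E y = 1 ->
  nbh (del E c Y) y = set0.
Proof.
move=> YN yY y1; rewrite nbh_del_leaf // (deg1_nbh y1 (v := c)) ?setDv //.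
by rewrite nbhC (subsetP YN).
Qed.

Lemma viol_isolated E s v : nbh E v = set0 -> ~~ viol E s v.
Proof. by move=> E0; rewrite /viol /deg E0 cards0. Qed.

(** * Reductions at a centre with at most one non-leaf neighbour *)

(** The smaller problem sees only the set [F], through the weight of [c]. So [g] may be chosen after
    [f], when the final sum at [c] is known. The leaves are isolated there, which leaves [s'] free
    on [Y]. *)
Lemma attach_leaves E s L c Y F s' f (g : T -> lab) :
  Y \subset nbh E c -> {in Y, forall y, deg E y = 1} ->
  F \subset L -> {in Y &, injective g} -> g @: Y = F ->
  labelling (del E c Y) (L :\: F) f -> separating (del E c Y) s' f ->
  s' c = s c + lsum F -> (forall v, v != c -> v \notin Y -> s' v = s v) ->
  {in Y, forall y, s y + ev (g y) != wsum (del E c Y) s' f c} ->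
  exists f1, [/\ labelling E L f1, separating E s f1
    & {in Y, forall y, wsum E s f1 y = s y + ev (g y)}].
Proof.
move=> YN Y1 FL ginj gF flab fprop s'c s's gc.
have [f1 [f1lab f1Y f1sum]] := ex_star_extension YN ginj gF FL flab.
have cY : c \notin Y by apply/negP=> /(subsetP YN)/nbh_neq; rewrite eqxx.
have sumY y : y \in Y -> wsum E s f1 y = s y + ev (g y).
  move=> yY; rewrite f1sum /wsum nbh_del_leaf0 ?Y1 // big_set0 addn0 /raise yY.
  by case: eqP yY cY => // -> ->.
have sumO v : v \notin Y -> wsum E s f1 v = wsum (del E c Y) s' f v.
  move=> vY; rewrite f1sum /wsum /raise (negPf vY); congr (_ + _).
  case: (eqVneq v c) => [->|vc]; last by rewrite addn0 s's.
  by rewrite s'c (lsum_imset ev ginj gF).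
exists f1; split=> // u v uv; case: (adj_delP YN uv) => [duv|[-> vY]|[-> uY]].
- have notY u' v' : adj (del E c Y) u' v' -> u' \notin Y.
    move=> d; apply/negP=> u'Y; have := nbh_del_leaf0 YN u'Y (Y1 _ u'Y).
    by move/setP/(_ v'); rewrite !inE d.
  have vu : adj (del E c Y) v u by rewrite adjC.
  by rewrite !sumO ?(notY _ _ duv) ?(notY _ _ vu) //; apply: fprop.
- by rewrite sumO // sumY // eq_sym gc.
- by rewrite (sumO c) // sumY // gc.
Qed.

(** Labels form an arbitrary set rather than an interval, because each deletion uses up arbitrary
    labels. *)
Definition solvable_below n := forall E s L, #|E| < n -> pairs E ->
  #|L| = #|E| -> {in L, forall i, 0 < ev i} -> (forall v, ~~ viol E s v) ->
  good E s L.

Lemma solve_del E s L c Y F : solvable_below #|E| -> pairs E ->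
  #|L| = #|E| -> {in L, forall i, 0 < ev i} ->
  Y \subset nbh E c -> 0 < #|Y| -> F \subset L -> #|F| = #|Y| ->
  (forall v, ~~ viol (del E c Y) s v) -> good (del E c Y) s (L :\: F).
Proof.
move=> IH Ep LE Lpos YN Y0 FL FY nv; have EY := card_del YN; apply: IH => //.
- by rewrite EY -[X in X < _]addn0 ltn_add2l.
- exact: pairs_del.
- by rewrite cardsD (setIidPr FL) LE EY FY addnK.
- by move=> i /setDP[/Lpos].
Qed.

Lemma deg_le_card E v : deg E v <= #|E|.
Proof. by rewrite (card_del (subxx (nbh E v))) leq_addl. Qed.

(** The star is a whole component, so any [deg E c] labels can be set aside for it. That [c] is no
    violation lets them be distributed without a tie. *)
Lemma solve_star E s L c : solvable_below #|E| -> pairs E ->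
  #|L| = #|E| -> {in L, forall i, 0 < ev i} -> (forall v, ~~ viol E s v) ->
  0 < deg E c -> {in nbh E c, forall u, deg E u = 1} -> good E s L.
Proof.
move=> IH Ep LE Lpos nv c0 leaves; set Y := nbh E c.
have [|F FL FY] := @ex_subset_card _ L #|Y|; first by rewrite LE deg_le_card.
have YN : Y \subset nbh E c by [].
have nv' v : ~~ viol (del E c Y) s v.
  case: (eqVneq v c) => [->|vc].
    by apply: viol_isolated; rewrite nbh_del_center // setDv.
  case: (boolP (v \in Y)) => vY.
    by apply/viol_isolated/nbh_del_leaf0 => //; apply: leaves.
  rewrite (viol_eq (s := s) (E := E)) //; first by rewrite nbh_del_other.
  move=> u uv; rewrite /deg nbh_del_other //.
    by apply: contraNneq vY => uc; rewrite /Y -uc nbhC.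
  apply/negP=> uY; have := deg1_nbh (leaves _ uY) (v := c).
  rewrite nbhC => /(_ uY) H; move: uv; rewrite nbhC H inE => /eqP E'.
  by rewrite E' eqxx in vc.
have [f flab fprop] := solve_del IH Ep LE Lpos YN c0 FL FY nv'.
have [g [ginj gF gc]] : exists g : {ffun T -> lab}, [/\ {in Y &, injective g},
    g @: Y = F & {in Y, forall y, s y + ev (g y) != s c + lsum F}].
  have YF : #|Y| = #|F| by [].
  have [g [ginj gF]] := ex_bij YF i0.
  have gin y : y \in Y -> g y \in F by move=> yY; rewrite -gF imset_f.
  have := nv c; rewrite /viol c0 /=.
  rewrite (_ : [forall u in _, _ == 1]) /=; last first.
    by apply/forall_inP=> u /leaves ->.
  rewrite negb_and => /orP[]; rewrite negb_forall_in => /exists_inP[u uY].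
    (* With a single leaf both ends get the same label, so unequal weights suffice. *)
    case: ifP => [/eqP c1 suc|c1 suc].
      have Yu := deg1_nbh c1 uY; exists g; split=> // y yY.
      have yu : y = u by move: yY; rewrite /Y Yu inE => /eqP.
      have Fg : F = [set g y] by rewrite -gF /Y Yu yu imset_set1.
      by rewrite Fg /lsum big_set1 eqn_add2r yu.
    case: (boolP [exists w in Y, s w != s u]) => [/exists_inP[w wY wu]|].
      by have [h [? ? ?]] := ex_bij_avoid ev_inj (s c + lsum F) YF wY uY wu; exists h.
    rewrite negb_exists_in => /forall_inP Hw; exists g; split=> // y yY.
    have /eqP -> : s y == s u by have := Hw y yY; rewrite negbK.
    (* The leaves share a weight at most [s c], and [c] gets a positive label besides [g y], so it
       ends strictly above. *)
    rewrite neq_ltn (_ : _ < _) // (lsumD1 ev (gin y yY)).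
    have [z zY zy] : exists2 z, z \in Y & z != y.
      have : 0 < #|Y :\ y| by move: c0 c1; rewrite /deg -/Y (cardsD1 y Y) yY; case: #|_|.
      by case/card_gt0P=> z; rewrite in_setD1 => /andP[zy zY]; exists z.
    have gzF : g z \in F :\ g y.
      by rewrite !inE gin // andbT; apply: contraNneq zy => /ginj ->.
    rewrite (lsumD1 ev gzF) -leqNgt in suc *.
    have := Lpos _ (subsetP FL _ (gin z zY)); move: suc; clear; lia.
  rewrite negb_forall_in => /exists_inP[w wY uw].
  by have [h [? ? ?]] := ex_bij_avoid ev_inj (s c + lsum F) YF uY wY uw; exists h.
have cY : c \notin Y by apply/negP=> /nbh_neq; rewrite eqxx.
pose s' v := if v == c then s c + lsum F else s v.
have same v : v != c -> s' v = s v by rewrite /s' => /negPf ->.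
have [||||f1 [f1lab f1prop _]] :=
  @attach_leaves E s L c Y F s' f g YN leaves FL ginj gF flab.
- move=> u v uv.
  have nbhc v' : c \notin nbh (del E c Y) v'.
    by rewrite nbhC nbh_del_center // setDv inE.
  have uc : u != c.
    by apply/eqP=> uc; have := nbhc v; rewrite nbhC in_nbh -[X in adj _ X]uc uv.
  have vc : v != c.
    by apply/eqP=> vc; have := nbhc u; rewrite in_nbh -[X in adj _ _ X]vc uv.
  by rewrite /wsum !same //; apply: fprop.
- by rewrite /s' eqxx.
- by move=> v vc _; apply: same.
- move=> y yY; rewrite /wsum nbh_del_center // setDv big_set0 addn0 /s' eqxx.
  exact: gc.
by exists f1.
Qed.

(** Without its leaves, [c] is a leaf of [x] of weight [s c + lsum F]. A new violation could only
    arise at [x], where [w] then has a weight other than that of [c]. The label [b] is the one that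
    the recursion puts on the edge between [c] and [x]. *)
Lemma solve_branch E s L c x F : solvable_below #|E| -> pairs E ->
  #|L| = #|E| -> {in L, forall i, 0 < ev i} -> (forall v, ~~ viol E s v) ->
  x \in nbh E c -> 1 < deg E c -> 1 < deg E x ->
  {in nbh E c :\ x, forall y, deg E y = 1} ->
  F \subset L -> #|F| = #|nbh E c :\ x| ->
  ({in nbh E x :\ c, forall u, deg E u = 1} ->
    exists2 w, w \in nbh E x :\ c & s w != s c + lsum F) ->
  (forall b, b \in L :\: F -> exists g : {ffun T -> lab},
    [/\ {in nbh E c :\ x &, injective g}, g @: (nbh E c :\ x) = F
      & {in nbh E c :\ x, forall y, s y + ev (g y) != s c + lsum F + ev b}]) ->
  good E s L.
Proof.
move=> IH Ep LE Lpos nv xc c1 x1 leaves FL FY HK HM; set Y := nbh E c :\ x.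
have YN : Y \subset nbh E c by apply: subsetDl.
have Y0 : 0 < #|Y| by move: c1; rewrite /deg (cardsD1 x) xc.
have xY : x \notin Y by rewrite !inE eqxx.
have x_c : x != c := nbh_neq xc.
have Y_c y : y \in Y -> nbh E y = [set c].
  by move=> yY; apply: deg1_nbh; [exact: leaves | rewrite nbhC (subsetP YN)].
pose s' v := if v == c then s c + lsum F else s v.
have same v : v != c -> s' v = s v by rewrite /s' => /negPf ->.
have Nc : nbh (del E c Y) c = [set x].
  by rewrite nbh_del_center // setDDr setDv set0U; apply/setIidPr; rewrite sub1set.
have Nx : nbh (del E c Y) x = nbh E x by rewrite nbh_del_other.
have nv' v : ~~ viol (del E c Y) s' v.
  case: (eqVneq v c) => [->|vc].
    rewrite /viol Nc; apply/negP=> /and4P[_ /forall_inP H _ _].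
    by have := H x; rewrite inE eqxx /deg Nx => /(_ isT); move: x1; rewrite /deg; case: #|_| => [|[]].
  case: (boolP (v \in Y)) => vY.
    by apply/viol_isolated/nbh_del_leaf0 => //; apply: leaves.
  case: (eqVneq v x) => [->|vx].
    apply/negP=> /and4P[_ /forall_inP H1 _ /forall_inP H2].
    have cx : c \in nbh (del E c Y) x by rewrite Nx nbhC.
    have [|w] := HK.
      move=> u /setD1P[uc ux]; have := H1 u; rewrite Nx => /(_ ux).
      rewrite /deg nbh_del_other // => [/eqP //|].
      by apply/negP=> /Y_c E'; move: ux; rewrite nbhC E' inE (negPf x_c).
    case/setD1P=> wc wx; case/negP; rewrite -Nx in wx.
    by have /forall_inP/(_ c cx) := H2 w wx; rewrite same // /s' eqxx.
  rewrite (viol_eq (s := s) (E := E)) //; rewrite ?nbh_del_other ?same //.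
    move=> u uv; rewrite /deg nbh_del_other //.
      apply/eqP=> uc; case/negP: vY; rewrite in_setD1 vx /= -uc nbhC //.
    by apply/negP=> /Y_c E'; move: uv; rewrite nbhC E' inE (negPf vc).
  move=> u uv; apply: same; apply/eqP=> uc; case/negP: vY.
  by rewrite in_setD1 vx /= -uc nbhC.
have [f flab fprop] := solve_del IH Ep LE Lpos YN Y0 FL FY nv'.
have bL : f [set c; x] \in L :\: F.
  have : x \in nbh (del E c Y) c by rewrite Nc inE.
  by rewrite in_nbh => /andP[_ H]; case: flab => _; apply.
have [g [ginj gF gc]] := HM _ bL.
have [|||f1 [f1lab f1prop _]] :=
  @attach_leaves E s L c Y F s' f g YN leaves FL ginj gF flab fprop.
- by rewrite /s' eqxx.
- by move=> v vc _; apply: same.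
- by move=> y yY; rewrite /wsum Nc big_set1 /s' eqxx; apply: gc.
by exists f1.
Qed.

(** Deleting only the leaves of [c] with labels [F] would turn [c] into a leaf of weight [a] like
    the others, possibly a violation at [x]. The whole component is removed instead and restored in
    two stages: the edges at [x], with [c] as a leaf, then the leaves of [c]. *)
Lemma solve_double_star E s L c x F a : solvable_below #|E| -> pairs E ->
  #|L| = #|E| -> {in L, forall i, 0 < ev i} -> (forall v, ~~ viol E s v) ->
  x \in nbh E c -> 1 < deg E c -> 1 < deg E x ->
  {in nbh E c :\ x, forall y, deg E y = 1} ->
  {in nbh E x :\ c, forall y, deg E y = 1} ->
  {in nbh E c :\ x, forall y, s y = a} -> {in nbh E x :\ c, forall y, s y = a} ->
  F \subset L -> #|F| = #|nbh E c :\ x| -> s c + lsum F = a ->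
  good E s L.
Proof.
move=> IH Ep LE Lpos nv xc c1 x1 cleaves xleaves sc sx FL FY scF.
set Y := nbh E c :\ x; set X := nbh E x :\ c.
have cx : c \in nbh E x by rewrite nbhC.
have YN : Y \subset nbh E c by apply: subsetDl.
have Y0 : 0 < #|Y| by move: c1; rewrite /deg (cardsD1 x) xc.
have X0 : 0 < #|X| by move: x1; rewrite /deg (cardsD1 c) cx.
have xY : x \notin Y by rewrite !inE eqxx.
have x_c : x != c := nbh_neq xc.
have Y_c y : y \in Y -> nbh E y = [set c].
  by move=> yY; apply: deg1_nbh; [exact: cleaves | rewrite nbhC (subsetP YN)].
have X_x y : y \in X -> nbh E y = [set x].
  by move=> yX; apply: deg1_nbh; [exact: xleaves | rewrite nbhC; case/setD1P: yX].
have XY y : y \in X -> y \notin Y.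
  move=> /X_x H; apply/negP=> /Y_c; rewrite H => /setP/(_ x).
  by rewrite !inE eqxx (negPf x_c).
pose E1 := del E c Y; pose Z := nbh E1 x; pose E2 := del E1 x Z.
have Nc1 : nbh E1 c = [set x].
  by rewrite nbh_del_center // setDDr setDv set0U; apply/setIidPr; rewrite sub1set.
have Zx : Z = nbh E x by rewrite /Z nbh_del_other.
have ZN : Z \subset nbh E1 x by [].
have cZ : c \in Z by rewrite Zx.
have ZX : Z :\ c = X by rewrite Zx.
have NX y : y \in X -> nbh E1 y = [set x].
  by move=> yX; have [yc _] := setD1P yX; rewrite nbh_del_other ?XY // X_x.
have Z1 : {in Z, forall y, deg E1 y = 1}.
  move=> y yZ; case: (eqVneq y c) => [->|yc]; first by rewrite /deg Nc1 cards1.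
  by rewrite /deg NX ?cards1 // -ZX in_setD1 yc.
have cardZ : #|Z| = #|X|.+1 by rewrite (cardsD1 c) cZ ZX.
have cardE : #|E| = #|E2| + #|Z| + #|Y|.
  by rewrite (card_del YN) (card_del ZN).
have [|G GLF GZ] := @ex_subset_card _ (L :\: F) #|Z|.
  by rewrite cardsD (setIidPr FL) LE FY cardE addnK leq_addl.
have [||||F' [P [b [[F'L PL bL] [F'P bF' bP] [F'c Pc] [HF HP] HFP]]]] :=
  @ex_double_star_split _ ev ev_inj L (s c) (s x) a F G FL _ _ _ _ scF.
- by apply: subset_trans GLF _; apply: subsetDl.
- by move=> i iF; apply/negP=> /(subsetP GLF); rewrite inE iF.
- by rewrite FY.
- by rewrite GZ cardZ ltnS.
rewrite FY in F'c; rewrite GZ cardZ /= in Pc.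
pose s1 v := if v == c then s c + lsum F' else s v.
have same1 v : v != c -> s1 v = s v by rewrite /s1 => /negPf ->.
pose P' := b |: P.
have P'L : P' \subset L :\: F'.
  apply/subsetP=> i; rewrite !inE => /orP[/eqP->|iP]; first by rewrite bF' bL.
  by rewrite (subsetP PL) // andbT; apply/negP=> /F'P; rewrite iP.
have P'Z : #|P'| = #|Z| by rewrite cardsU1 bP Pc cardZ.
have P'sum : lsum P' = ev b + lsum P by apply: lsumU1.
pose s2 v := if v == x then s x + lsum P' else s1 v.
have [f2 f2lab f2prop] : good E2 s2 (L :\: F' :\: P').
  apply: IH.
  - by rewrite cardE cardZ; move: Y0; clear; lia.
  - by do 2!apply: pairs_del.
  - rewrite cardsD (setIidPr P'L) cardsD (setIidPr F'L) LE F'c P'Z cardE.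
    by rewrite addnK addnK.
  - by move=> i /setDP[/setDP[/Lpos]].
  move=> v; case: (eqVneq v x) => [->|vx].
    by apply: viol_isolated; rewrite nbh_del_center // setDv.
  case: (boolP (v \in Z)) => vZ.
    by apply/viol_isolated/nbh_del_leaf0 => //; apply: Z1.
  have vc : v != c by apply: contraNneq vZ => ->.
  have N2 : nbh E2 v = nbh E1 v by rewrite nbh_del_other.
  case: (boolP (v \in Y)) => vY.
    apply: viol_isolated; rewrite N2; apply: nbh_del_leaf0 => //.
    exact: cleaves.
  have N1 : nbh E1 v = nbh E v by rewrite nbh_del_other.
  have outside u : u \in nbh E v -> [/\ u != c, u != x, u \notin Y & u \notin Z].
    move=> uv; have uc : u != c.
      by apply: contraNneq vY => uc; rewrite in_setD1 vx /= -uc nbhC.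
    split=> //.
    - by apply: contraNneq vZ => ux; rewrite Zx -ux nbhC.
    - by apply/negP=> /Y_c H; move: uv; rewrite nbhC H inE (negPf vc).
    apply/negP=> uZ; have /X_x H : u \in X by rewrite -ZX in_setD1 uc.
    by move: uv; rewrite nbhC H inE (negPf vx).
  rewrite (viol_eq (s := s) (E := E)) //.
  - by rewrite N2.
  - move=> u /outside[uc ux uY uZ].
    by rewrite /deg (nbh_del_other ZN) // nbh_del_other.
  - by rewrite /s2 (negPf vx) same1.
  - by move=> u /outside[uc ux uY uZ]; rewrite /s2 (negPf ux) same1.
(* The edge between the centres must get [b]; one exchange makes the bijection send [c] to [b]. *)
have [g0 [g0inj g0P]] := ex_bij (esym P'Z) i0.
have [z zZ g0z] : exists2 z, z \in Z & g0 z = b.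
  have bP' : b \in P' by apply: setU11.
  by move: bP'; rewrite -g0P => /imsetP[z zZ ->]; exists z.
pose g1 := swapf g0 c z; have [g1inj g1P] := swapf_bij cZ zZ g0inj g0P.
have g1c : g1 c = b by rewrite ffunE eqxx.
have Sx : wsum E2 s2 f2 x = s x + lsum P + ev b.
  rewrite /wsum nbh_del_center // setDv big_set0 addn0 /s2 eqxx P'sum.
  by rewrite [ev b + _]addnC addnA.
have [|||f1 [f1lab f1prop f1Z]] :=
  @attach_leaves E1 s1 (L :\: F') x Z P' s2 f2 g1 ZN Z1 P'L g1inj g1P f2lab f2prop.
- by rewrite /s2 eqxx same1.
- by move=> v vx _; rewrite /s2 (negPf vx).
- move=> y yZ; rewrite Sx; case: (eqVneq y c) => [->|yc].
    by rewrite g1c eqn_add2r /s1 eqxx.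
  have yX : y \in X by rewrite -ZX in_setD1 yc.
  rewrite same1 // sx // eq_sym HP //.
  have : g1 y \in P' by rewrite -g1P imset_f.
  case/setU1P=> //; rewrite -g1c => /g1inj E'.
  by rewrite E' ?eqxx in yc.
have [g [ginj gF]] := ex_bij (esym F'c) i0.
have [|||f3 [f3lab f3prop _]] :=
  @attach_leaves E s L c Y F' s1 f1 g YN cleaves F'L ginj gF f1lab f1prop.
- by rewrite /s1 eqxx.
- by move=> v vc _; apply: same1.
- move=> y yY; rewrite f1Z // g1c /s1 eqxx sc // eq_sym HF //.
  by rewrite -gF imset_f.
by exists f3.
Qed.

(** Leaves of unequal weights are handled by [ex_bij_avoid]. For a common weight, the cases are
    whether or not some label set lifts [c] to that weight. *)
Lemma solve_one_inner E s L c x : solvable_below #|E| -> pairs E ->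
  #|L| = #|E| -> {in L, forall i, 0 < ev i} -> (forall v, ~~ viol E s v) ->
  x \in nbh E c -> 1 < deg E c -> 1 < deg E x ->
  {in nbh E c :\ x, forall y, deg E y = 1} -> good E s L.
Proof.
move=> IH Ep LE Lpos nv xc c1 x1 leaves; set Y := nbh E c :\ x.
have degc : deg E c = #|Y|.+1 by rewrite /deg (cardsD1 x) xc.
have Y0 : 0 < #|Y| by rewrite -ltnS -degc.
have [y0 y0Y] := card_gt0P Y0.
have cx : c \in nbh E x by rewrite nbhC.
have /card_gt0P[w wx] : 0 < #|nbh E x :\ c|.
  by move: x1; rewrite /deg (cardsD1 c) cx.
have YL : #|Y| < #|L| by rewrite LE -degc deg_le_card.
have generic : (forall F b, F \subset L -> #|F| = #|Y| -> b \in L :\: F ->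
    exists g : {ffun T -> lab}, [/\ {in Y &, injective g}, g @: Y = F
      & {in Y, forall y, s y + ev (g y) != s c + lsum F + ev b}]) -> good E s L.
  (* [F] is chosen to make the new weight of [c] differ from [s w]. Truncation in [s w - s c] is
     harmless: when [s w < s c], they differ for every [F]. *)
  move=> H; have [|F [FL FY Fw]] := @ex_subset_sum_neq _ ev ev_inj L #|Y| (s w - s c).
    by rewrite Y0.
  apply: (solve_branch (F := F) IH Ep LE Lpos nv xc) => // [_|b bL].
    by exists w => //; move: Fw; clear; lia.
  exact: H.
case: (boolP [exists y in Y, s y != s y0]) => [/exists_inP[y yY yy0]|].
  apply: generic => F b FL FY bL.
  exact: (ex_bij_avoid ev_inj _ (esym FY) yY y0Y yy0).
rewrite negb_exists_in => /forall_inP const.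
have {}const : {in Y, forall y, s y = s y0}.
  by move=> y yY; apply/eqP; have := const y yY; rewrite negbK.
case: (boolP [exists F : {set lab}, [&& F \subset L, #|F| == #|Y| & s c + lsum F == s y0]]).
  case/existsP=> F /and3P[FL /eqP FY /eqP Fs].
  (* With this [F], [c] becomes a leaf of weight [s y0]. This is safe unless all other neighbours of
     [x] are leaves of that weight too, which is the double star case. *)
  case: (boolP [forall u in nbh E x :\ c, (deg E u == 1) && (s u == s y0)]).
    move/forall_inP=> H; apply: (solve_double_star IH Ep LE Lpos nv xc) Fs => //.
      by move=> y /H/andP[/eqP].
    by move=> y /H/andP[_ /eqP].
  rewrite negb_forall_in => /exists_inP[u ux Hu].
  apply: (solve_branch (F := F) IH Ep LE Lpos nv xc) => // [H|b].
    by exists u => //; move: Hu; rewrite H // Fs.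
  rewrite inE => /andP[bF bL]; have [g [ginj gF]] := ex_bij (esym FY) i0.
  exists g; split=> // y yY; rewrite const // Fs eqn_add2l.
  by apply: contraNneq bF => /ev_inj <-; rewrite -gF imset_f.
rewrite negb_exists => /forallP noF; apply: generic => F b FL FY.
rewrite inE => /andP[bF bL]; have [g [ginj gF]] := ex_bij (esym FY) i0.
exists g; split=> // y yY; rewrite const //.
have gy : g y \in F by rewrite -gF imset_f.
(* If [y] tied with [c], exchanging [g y] for [b] in [F] would give a set lifting [c] to [s y0]. *)
have := noF (b |: F :\ g y); rewrite sub_swap // card_swap // FY eqxx /=.
have := lsum_swap ev gy bF; move: (lsum _) (lsum _) => A B; clear; lia.
Qed.

Lemma viol_leaf E s v u : viol E s v -> u \in nbh E v -> deg E u = 1.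
Proof. by case/and4P=> _ /forall_inP H _ _ /H/eqP. Qed.

Lemma viol_const E s v u w : viol E s v -> u \in nbh E v -> w \in nbh E v ->
  s u = s w.
Proof. by case/and4P=> _ _ _ /forall_inP H /H/forall_inP H' /H'/eqP. Qed.

Lemma viol_edge E s v u : viol E s v -> deg E v = 1 -> u \in nbh E v -> s u = s v.
Proof. by case/and4P=> _ _ /forall_inP H _ v1 /H; rewrite v1 eqxx => /eqP. Qed.

(** * Peeling off a vertex with all its edges *)

Section Peel.

Variables (E : {set {set T}}) (s : T -> nat) (L : {set lab}) (x : T).
Local Notation W := (nbh E x).
Local Notation E' := (del E x W).

Lemma nbh_peel v : v != x -> nbh E' v = nbh E v :\ x.
Proof.
move=> vx; case: (boolP (v \in W)) => vW; first exact: nbh_del_leaf.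
rewrite nbh_del_other //; apply/setP=> u; rewrite in_setD1.
by case: eqP => // ->; rewrite nbhC (negPf vW).
Qed.

Lemma nbh_peel_center : nbh E' x = set0.
Proof. by rewrite nbh_del_center // setDv. Qed.

Lemma deg_peel v : v != x -> deg E v = (v \in W) + deg E' v.
Proof. by move=> vx; rewrite /deg nbh_peel // (cardsD1 x) nbhC. Qed.

Lemma raise_swap (g : {ffun T -> lab}) a b v : a \in W -> b \in W ->
  v != a -> v != b -> raise s x W (swapf g a b) v = raise s x W g v.
Proof.
move=> aW bW va vb; rewrite /raise; case: (eqVneq v x) => [vx|vx].
  congr (_ + _); rewrite (bigD1 a) // [RHS](bigD1 a) //=.
  case: (eqVneq a b) => [<-|ab].
    congr (_ + _); first by rewrite ffunE eqxx.
    by apply: eq_bigr => u /andP[_ ua]; rewrite ffunE (negPf ua).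
  rewrite (bigD1 b) ?bW 1?eq_sym //= [in RHS](bigD1 b) ?bW 1?eq_sym //=.
  rewrite !addnA !ffunE eqxx [b == a]eq_sym (negPf ab) eqxx; congr (_ + _).
    exact: addnC.
  apply: eq_bigr => u /andP[/andP[_ ua] ub].
  by rewrite ffunE (negPf ua) (negPf ub).
by case: ifP => // _; rewrite ffunE (negPf va) (negPf vb).
Qed.

Lemma raise_nbh (g : T -> lab) v : v \in W -> raise s x W g v = s v + ev (g v).
Proof. by move=> vW; rewrite /raise (negPf (nbh_neq vW)) vW. Qed.

(** The two hypotheses describe what remains once star components and centres with a single non-leaf
    neighbour are treated. *)
Hypothesis inner1 : forall v, 0 < deg E v -> exists2 u, u \in nbh E v & 1 < deg E u.
Hypothesis inner2 : forall v, 1 < deg E v -> exists u1 u2,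
  [/\ u1 \in nbh E v, u2 \in nbh E v, u1 != u2, 1 < deg E u1 & 1 < deg E u2].

Lemma peel_inner v : v != x -> 1 < deg E v ->
  exists2 u, u \in nbh E' v & 1 < deg E u.
Proof.
move=> vx /inner2[u1 [u2 [u1v u2v u12 d1 d2]]]; rewrite nbh_peel //.
case: (eqVneq u1 x) => [u1x|u1x].
  by exists u2; rewrite // in_setD1 u2v -u1x eq_sym u12.
by exists u1; rewrite // in_setD1 u1x.
Qed.

(** A violating [v] has a neighbour [u] that is a leaf of [E'] but not of [E]. Yet [u] has two
    non-leaf neighbours, neither being the leaf [x], so it keeps degree at least two. *)
Lemma peel_leaf_viol s' v : deg E x = 1 -> ~~ viol E' s' v.
Proof.
move=> x1; apply/negP=> V; have v0 : 0 < deg E' v by case/and4P: V.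
have vx : v != x by apply: contraTneq v0 => ->; rewrite /deg nbh_peel_center cards0.
have [u uv u1] : exists2 u, u \in nbh E v & 1 < deg E u.
  by apply: inner1; rewrite deg_peel // ltn_addl.
have ux : u != x by apply: contraTneq u1 => ->; rewrite x1.
have uE' : u \in nbh E' v by rewrite nbh_peel // in_setD1 ux.
have := viol_leaf V uE'; have := deg_peel ux.
case: (boolP (u \in W)) => uW du du'; last by rewrite du du' in u1.
have [a [b [aN bN ab a1 b1]]] := inner2 u1.
have : 1 < deg E' u; last by rewrite du'.
rewrite /deg nbh_peel //; have -> : 2 = #|[set a; b]| by rewrite cards2 ab.
apply: subset_leq_card; apply/subsetP=> z; rewrite !inE => /orP[] /eqP ->.
  by rewrite -in_nbh aN andbT; apply: contraTneq a1 => ->; rewrite x1.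
by rewrite -in_nbh bN andbT; apply: contraTneq b1 => ->; rewrite x1.
Qed.

(* All violations lie in distinct components of [E'], and each one is repaired
   by exchanging two labels inside its component. *)
Lemma viol_swap (g : {ffun T -> lab}) v : {in W &, injective g} ->
  viol E' (raise s x W g) v -> exists a b,
    [/\ [/\ a \in W, b \in W, 1 < deg E a & 1 < deg E b],
        a \in v |: nbh E' v, b \in v |: nbh E' v
      & ~~ viol E' (raise s x W (swapf g a b)) v].
Proof.
move=> ginj V; have v0 : 0 < deg E' v by case/and4P: V.
have vx : v != x by apply: contraTneq v0 => ->; rewrite /deg nbh_peel_center cards0.
have nx u : u \in nbh E' v -> u != x by rewrite nbh_peel // => /setD1P[].
have neq_g a b : a \in W -> b \in W -> a != b -> ev (g a) <> ev (g b).
  by move=> aW bW ab /ev_inj/ginj E1; rewrite E1 ?eqxx in ab.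
have swapl a b : a \in W -> raise s x W (swapf g a b) a = s a + ev (g b).
  by move=> aW; rewrite raise_nbh // ffunE eqxx.
have swapr a b : b \in W -> raise s x W (swapf g a b) b = s b + ev (g a).
  by move=> bW; rewrite raise_nbh // ffunE; case: eqP => [->|]; rewrite ?eqxx.
have inW u : u \in nbh E' v -> 1 < deg E u -> u \in W.
  move=> uv; rewrite deg_peel ?nx // (viol_leaf V uv).
  by case: (u \in W).
(* In a single-edge component both ends turn out to be non-leaf neighbours of [x]. Equal weights
   before and after exchanging their labels would force equal labels. *)
case: (eqVneq (deg E' v) 1) => [v1|v1].
  have [u uv] := card_gt0P v0; have Nv := deg1_nbh v1 uv.
  have vu : v \in nbh E' u by rewrite nbhC.
  have Nu := deg1_nbh (viol_leaf V uv) vu; have ux := nx u uv.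
  have vW : v \in W.
    apply: contraT => vW; have dv : deg E v = 1 by rewrite deg_peel // (negPf vW) v1.
    have [|w wv w1] := @inner1 v; first by rewrite dv.
    have wE' : w \in nbh E' v.
      by rewrite nbh_peel // in_setD1 wv andbT; apply: contraNneq vW => <-; rewrite nbhC.
    have wu : w = u by move: wE'; rewrite Nv inE => /eqP.
    rewrite wu in w1; have [z] := peel_inner ux w1.
    by rewrite Nu inE => /eqP ->; rewrite dv.
  have dv : 1 < deg E v by rewrite deg_peel // vW v1.
  have uW : u \in W.
    by have [z] := peel_inner vx dv; rewrite Nv inE => /eqP -> /(inW u uv).
  have du : 1 < deg E u by rewrite deg_peel // uW (viol_leaf V uv).
  exists u, v; split=> //; rewrite ?setU11 ?inE -?in_nbh ?uv ?orbT //.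
  have uv' : u != v := nbh_neq uv.
  apply/negP=> V'; have := viol_edge V' v1 uv; have := viol_edge V v1 uv.
  rewrite swapl // swapr // !raise_nbh //; have := neq_g u v uW vW uv'.
  by clear; lia.
have v2 : 1 < deg E' v by move: v0 v1; case: (deg E' v) => [|[]].
have dv : 1 < deg E v by rewrite deg_peel // ltn_addl.
have [u1 [u2 [u1v u2v u12 d1 d2]]] := inner2 dv.
(* When [v] is adjacent to [x], exchanging the labels of [v] and of its leaf [u] changes the weight
   of [u] but not of another leaf [z]. *)
have through u : u \in nbh E v -> u != x -> 1 < deg E u -> v \in W -> exists a b,
    [/\ [/\ a \in W, b \in W, 1 < deg E a & 1 < deg E b],
        a \in v |: nbh E' v, b \in v |: nbh E' v
      & ~~ viol E' (raise s x W (swapf g a b)) v].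
  move=> uv ux du vW; have uE' : u \in nbh E' v by rewrite nbh_peel // in_setD1 ux.
  have uW := inW u uE' du.
  exists u, v; split=> //; rewrite ?setU11 ?inE -?in_nbh ?uE' ?orbT //.
  have /card_gt0P[z] : 0 < #|nbh E' v :\ u| by move: v2; rewrite /deg (cardsD1 u) uE'.
  case/setD1P=> zu zv; apply/negP=> V'.
  have := viol_const V' uE' zv; have := viol_const V uE' zv.
  rewrite swapl // raise_swap ?(nbh_neq zv) // raise_nbh //.
  by have := neq_g u v uW vW (nbh_neq uE'); clear; lia.
case: (eqVneq u1 x) => [u1x|u1x].
  apply: (through u2) => //; first by rewrite -u1x eq_sym.
  by rewrite nbhC -u1x.
case: (eqVneq u2 x) => [u2x|u2x].
  by apply: (through u1) => //; rewrite nbhC -u2x.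
have u1E : u1 \in nbh E' v by rewrite nbh_peel // in_setD1 u1x.
have u2E : u2 \in nbh E' v by rewrite nbh_peel // in_setD1 u2x.
have u1W := inW u1 u1E d1; have u2W := inW u2 u2E d2.
(* Both are leaves of [E'] but not of [E], so both got labels from [x]; exchanging these makes their
   equal weights differ. *)
exists u1, u2; split=> //; try by rewrite inE ?u1E ?u2E orbT.
apply/negP=> V'; have := viol_const V' u1E u2E; have := viol_const V u1E u2E.
rewrite swapl // swapr // !raise_nbh //.
by have := neq_g u1 u2 u1W u2W u12; clear; lia.
Qed.

(** The exchange changes weights only in the closed neighbourhood of [v]. A violating [v'] either
    has a disjoint one or forms an edge component with [v], where violation is symmetric and [v] has
    been repaired. *)
Lemma viol_swap_sub (g : {ffun T -> lab}) v a b v' :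
  viol E' (raise s x W g) v -> a \in W -> b \in W ->
  a \in v |: nbh E' v -> b \in v |: nbh E' v ->
  ~~ viol E' (raise s x W (swapf g a b)) v ->
  viol E' (raise s x W (swapf g a b)) v' -> viol E' (raise s x W g) v'.
Proof.
move=> V aW bW av bv nV V'.
case: (eqVneq v' v) => [E1|v'v]; first by rewrite E1 (negPf nV) in V'.
case: (boolP (v' \in nbh E' v)) => v'N.
  case/negP: nV; have vN : v \in nbh E' v' by rewrite nbhC.
  have v1 := viol_leaf V' vN; have v'1 := viol_leaf V v'N.
  have Nv := deg1_nbh v1 v'N; have e := viol_edge V' v'1 vN.
  rewrite /viol v1 eqxx /= Nv; apply/and3P; split.
  - by apply/forall_inP=> u; rewrite inE => /eqP ->; rewrite v'1.
  - by apply/forall_inP=> u; rewrite inE => /eqP ->; rewrite e.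
  - apply/forall_inP=> u; rewrite inE => /eqP ->.
    by apply/forall_inP=> w; rewrite inE => /eqP ->.
have out u : u \in v' |: nbh E' v' -> u \notin v |: nbh E' v.
  rewrite !in_setU1 => /orP[/eqP->|uv']; first by rewrite (negPf v'v).
  rewrite negb_or; apply/andP; split.
    by apply: contraNneq v'N => <-; rewrite nbhC.
  apply/negP=> uv; have vu : v \in nbh E' u by rewrite nbhC.
  have Nu := deg1_nbh (viol_leaf V uv) vu.
  by move: uv'; rewrite nbhC Nu inE (negPf v'v).
have same u : u \in v' |: nbh E' v' ->
    raise s x W (swapf g a b) u = raise s x W g u.
  move=> /out u_out; apply: raise_swap => //.
    by apply: contraNneq u_out => ->.
  by apply: contraNneq u_out => ->.
rewrite -(viol_eq (s' := raise s x W (swapf g a b)) (E' := E')) //.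
  by rewrite same ?setU11.
by move=> u uv'; rewrite same // in_setU1 uv' orbT.
Qed.

(** Among the bijections giving no leaf the smallest label of [L], take one with fewest violations.
    The exchanges of [viol_swap] involve only non-leaves, so they stay in this class. *)
Lemma ex_peel_labels F : 1 < deg E x -> #|F| = deg E x ->
  exists g : {ffun T -> lab}, [/\ {in W &, injective g}, g @: W = F,
    {in W, forall y, deg E y = 1 -> ~~ lowset ev L [set g y]}
    & forall v, ~~ viol E' (raise s x W g) v].
Proof.
move=> x1 Fx.
pose nolow (g : {ffun T -> lab}) :=
  [forall y in W, (deg E y == 1) ==> ~~ lowset ev L [set g y]].
pose P (g : {ffun T -> lab}) := [&& dinjectiveb g W, g @: W == F & nolow g].
pose bad (g : {ffun T -> lab}) := [set v | viol E' (raise s x W g) v].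
have low1 i j : lowset ev L [set i] -> lowset ev L [set j] -> i = j.
  move=> li lj; have := lowset_nested ev_inj li lj; rewrite !cards1 => /(_ isT).
  by rewrite sub1set inE => /eqP.
have [g0 Pg0] : exists g0, P g0.
  have [g [ginj gF]] := ex_bij (esym Fx) i0.
  case: (boolP (nolow g)) => [ng|].
    by exists g; apply/and3P; split=> //; [exact/dinjectiveP | exact/eqP].
  rewrite negb_forall_in => /exists_inP[y yW]; rewrite negb_imply negbK.
  (* The leaf [y] passes the unique smallest label to a non-leaf neighbour of [x]. *)
  case/andP=> /eqP y1 ylow; have [z zW z1] := inner1 (ltnW x1).
  have [hinj hF] := swapf_bij yW zW ginj gF.
  exists (swapf g y z); apply/and3P; split; [exact/dinjectiveP | exact/eqP |].
  apply/forall_inP=> u uW; apply/implyP=> /eqP u1; apply/negP=> /(low1 _ _ ylow).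
  rewrite ffunE; case: (eqVneq u y) => [_|uy].
    by move/ginj=> E1; rewrite -E1 // y1 in z1.
  case: (eqVneq u z) => [E1|_]; first by rewrite -E1 u1 in z1.
  by move/ginj=> E1; rewrite E1 ?eqxx in uy.
case: (arg_minnP (fun g => #|bad g|) Pg0) => g.
case/and3P=> /dinjectiveP ginj /eqP gF /forall_inP ng gmin; exists g; split=> //.
  by move=> y yW y1; have := ng y yW; rewrite y1 eqxx.
move=> v; apply/negP=> V.
have [a [b [[aW bW a1 b1] av bv nV]]] := viol_swap ginj V.
have [hinj hF] := swapf_bij aW bW ginj gF.
have /gmin : P (swapf g a b).
  apply/and3P; split; [exact/dinjectiveP | exact/eqP |].
  apply/forall_inP=> u uW; apply/implyP=> u1; rewrite ffunE.
  case: (eqVneq u a) => [E1|_]; first by rewrite -E1 (eqP u1) in a1.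
  case: (eqVneq u b) => [E1|_]; first by rewrite -E1 (eqP u1) in b1.
  by have := ng u uW; rewrite u1.
rewrite leqNgt => /negP[]; apply: proper_card; apply/properP; split.
  by apply/subsetP=> v'; rewrite !in_set; apply: viol_swap_sub V aW bW av bv nV.
by exists v; rewrite !inE.
Qed.

End Peel.

(** * Recursion at a vertex of minimal potential, and the induction *)

(** A neighbour [y] ends with at least [s y + lsum (B y)], and [x] with exactly [s x + lsum (B x)].
    A tie makes the labels at [y] a lowest set, hence nested with [B x]. *)
Lemma solve_peel E s L x (B : T -> {set lab}) (g : T -> lab) :
  solvable_below #|E| -> pairs E ->
  #|L| = #|E| -> {in L, forall i, 0 < ev i} -> 0 < deg E x ->
  (forall v, lowset ev L (B v)) -> (forall v, #|B v| = deg E v) ->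
  {in nbh E x &, injective g} -> g @: nbh E x = B x ->
  (forall v, ~~ viol (del E x (nbh E x)) (raise s x (nbh E x) g) v) ->
  {in nbh E x, forall y, s x + lsum (B x) < s y + lsum (B y) \/
    [/\ s x + lsum (B x) <= s y + lsum (B y), 1 < deg E x
      & deg E y = 1 -> ~~ lowset ev L [set g y]]} ->
  good E s L.
Proof.
move=> IH Ep LE Lpos x0 Blow Bdeg ginj gB nv Hmin.
set W := nbh E x; have WN : W \subset nbh E x by [].
have [f flab fsep] := solve_del IH Ep LE Lpos WN x0 (lowset_sub (Blow x)) (Bdeg x) nv.
have [f1 [f1lab f1W f1sum]] := ex_star_extension WN ginj gB (lowset_sub (Blow x)) flab.
have Sx : wsum E s f1 x = s x + lsum (B x).
  rewrite f1sum /wsum nbh_del_center // setDv big_set0 addn0 /raise eqxx.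
  by rewrite (lsum_imset ev ginj gB).
have key y : y \in W -> wsum E s f1 x != wsum E s f1 y.
  move=> yW; have [FL Fdeg ->] := wsum_labels s y f1lab.
  set F := [set _ | _ in _] in FL Fdeg *; rewrite Sx.
  have Fge : lsum (B y) <= lsum F by apply: lowset_le (Blow y) FL _; rewrite Bdeg.
  case: (Hmin y yW) => [H1|[H1 x1 Hy]].
    by move: H1 Fge; clear; lia.
  apply/eqP=> Exy.
  have Flow : lowset ev L F.
    apply: lowset_eq (Blow y) FL _ _; first by rewrite Bdeg.
    by move: Exy H1 Fge; clear; lia.
  have common u w : u \in W -> w \in nbh E y -> g u = f1 [set y; w] -> u = y /\ w = x.
    move=> uW wN; rewrite -f1W // => /(f1lab.1 _ _ _ _) H.
    have xu : [set x; u] = [set y; w].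
      by apply: H; [move: uW | move: wN]; rewrite in_nbh => /andP[].
    have xu' : x != u by rewrite eq_sym (nbh_neq uW).
    case: (set2_eq xu' xu) => [[xy]|[-> ->]] //.
    by have := nbh_neq yW; rewrite xy eqxx.
  (* Only the edge between [x] and [y] is common. So [B x] inside the labels at [y] contradicts
     [1 < deg E x], and the reverse inclusion makes [y] a leaf holding the smallest label. *)
  case: (leqP (deg E x) (deg E y)) => dxy.
    have /subsetP sBF : B x \subset F 
      by apply: (lowset_nested ev_inj (Blow x) Flow); rewrite Fdeg Bdeg.
    have : W \subset [set y].
      apply/subsetP=> u uW; rewrite inE; apply/eqP.
      have /sBF/imsetP[w wN /(common u w uW wN)[]] // : g u \in B x by rewrite -gB imset_f.
    by move/subset_leq_card; rewrite cards1 leqNgt x1.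
  have /subsetP sFB : F \subset B x.
    by apply: (lowset_nested ev_inj Flow (Blow x)); rewrite Fdeg Bdeg ltnW.
  have xN : x \in nbh E y by rewrite nbhC.
  have Ny : nbh E y = [set x].
    apply/eqP; rewrite eqEsubset sub1set xN andbT; apply/subsetP=> w wN.
    rewrite inE; have : f1 [set y; w] \in F by apply: imset_f.
    move/sFB; rewrite -gB => /imsetP[u uW /esym/(common u w uW wN)[_ ->]].
    by rewrite eqxx.
  have y1 : deg E y = 1 by rewrite /deg Ny cards1.
  case/negP: (Hy y1); rewrite -f1W // setUC.
  by move: Flow; rewrite /F Ny imset_set1.
exists f1 => // u v uv; case: (adj_delP WN uv) => [duv|[-> vW]|[-> uW]].
- by rewrite !f1sum; apply: fsep.
- exact: key.
- by rewrite eq_sym key.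
Qed.

(** Minimise [p] over non-isolated vertices. A non-leaf minimiser is peeled. For a leaf [x], either
    its neighbour [w] is also a minimiser and is peeled, or [p x < p w] and peeling [x] is safe for
    any label. *)
Lemma solve_inner E s L : solvable_below #|E| -> pairs E ->
  #|L| = #|E| -> {in L, forall i, 0 < ev i} -> (exists v, 0 < deg E v) ->
  (forall v, 0 < deg E v -> exists2 u, u \in nbh E v & 1 < deg E u) ->
  (forall v, 1 < deg E v -> exists u1 u2,
    [/\ u1 \in nbh E v, u2 \in nbh E v, u1 != u2, 1 < deg E u1 & 1 < deg E u2]) ->
  good E s L.
Proof.
move=> IH Ep LE Lpos [v0 v0deg] inner1 inner2.
have exB v : exists2 F : {set lab}, lowset ev L F & #|F| = deg E v.
  by apply: ex_lowset; rewrite LE deg_le_card.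
have [B Blow Bdeg] := fin_all_exists2 exB.
pose p v := s v + lsum (B v).
case: (arg_minnP (P := fun v => 0 < deg E v) p v0deg) => x x0 xmin.
have inner_min z : 1 < deg E z -> (forall v, 0 < deg E v -> p z <= p v) -> good E s L.
  move=> z1 zmin; have [g [ginj gB glow nv]] := ex_peel_labels s L inner1 inner2 z1 (Bdeg z).
  apply: (solve_peel IH Ep LE Lpos (ltnW z1) Blow Bdeg ginj gB nv) => y yW; right.
  split=> //; last exact: glow.
  by apply: zmin; apply/card_gt0P; exists z; rewrite nbhC.
case: (leqP (deg E x) 1) => [x1|]; last by move/inner_min; apply.
have {}x1 : deg E x = 1 by apply/eqP; rewrite eqn_leq x1.
have [w wx w1] := inner1 x x0; have Nx := deg1_nbh x1 wx.
case: (leqP (p w) (p x)) => pwx.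
  by apply: (inner_min w) => // v /xmin; apply: leq_trans.
have [g [ginj gB]] := ex_bij (esym (Bdeg x)) i0.
apply: (solve_peel IH Ep LE Lpos x0 Blow Bdeg ginj gB) => [v|y].
  exact: peel_leaf_viol.
by rewrite Nx inE => /eqP ->; left.
Qed.

Theorem weighted_labelling n : solvable_below n.
Proof.
elim: n => // n IHn E s L; rewrite ltnS => En Ep LE Lpos nv.
have {IHn}IH : solvable_below #|E| by move=> E' s' L' lt; apply: IHn (leq_trans lt En).
case: (boolP [exists v, 0 < deg E v]) => [/existsP ex|]; last first.
  rewrite negb_exists => /forallP d0.
  have noadj u v : adj E u v = false.
    apply/negP=> uv; have := d0 u; rewrite -eqn0Ngt cards_eq0.
    by move/eqP/setP/(_ v); rewrite !inE uv.
  exists (fun _ => i0); last by move=> u v; rewrite noadj.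
  have E0 A : A \in E -> False.
    move=> AE; have /eqP/cards2P[x [y [xy EA]]] := Ep A AE.
    by have := noadj x y; rewrite /adj xy -EA AE.
  by split=> [A B /E0|A /E0].
case: (boolP [exists c, (0 < deg E c) && [forall u in nbh E c, deg E u == 1]]).
  case/existsP=> c /andP[c0 /forall_inP cl].
  by apply: solve_star nv c0 _ => // u /cl/eqP.
rewrite negb_exists => /forallP nostar.
have degN u v : u \in nbh E v -> 0 < deg E u.
  by move=> uv; apply/card_gt0P; exists v; rewrite nbhC.
have inner1 v : 0 < deg E v -> exists2 u, u \in nbh E v & 1 < deg E u.
  move=> v0; have := nostar v; rewrite v0 /= negb_forall_in => /exists_inP[u uv u1].
  by exists u => //; rewrite ltn_neqAle eq_sym u1 (degN u v).
case: (boolP [exists c, exists x in nbh E c, [&& 1 < deg E c, 1 < deg E x &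
    [forall y in nbh E c :\ x, deg E y == 1]]]).
  case/existsP=> c /exists_inP[x xc /and3P[c1 x1 /forall_inP H]].
  by apply: (solve_one_inner IH Ep LE Lpos nv xc c1 x1) => y /H/eqP.
rewrite negb_exists => /forallP noone; apply: solve_inner => // v v1.
have [u uv u1] := inner1 v (ltnW v1); exists u.
have := noone v; rewrite negb_exists_in => /forall_inP/(_ u uv).
rewrite v1 u1 /= negb_forall_in => /exists_inP[w /setD1P[wu wv] w1].
by exists w; split; rewrite // 1?eq_sym // ltn_neqAle eq_sym w1 (degN w v).
Qed.

End Weighted.

(** * Back to simple graphs *)

Section SimpleGraph.

Variables (T : finType) (e : rel T).
Hypothesis Hgraph : simple_graph e.

Lemma pairs_edges : pairs (edges e).
Proof.
case: Hgraph => _ eirr A; rewrite inE => /existsP[x /existsP[y /andP[xy /eqP->]]].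
by rewrite cards2 (_ : x != y) //; apply: contraTneq xy => ->; rewrite eirr.
Qed.

Lemma adj_edges u v : adj (edges e) u v = e u v.
Proof.
case: Hgraph => esym eirr; rewrite /adj inE; apply/andP/idP.
  case=> uv /existsP[x /existsP[y /andP[xy /eqP E]]].
  by case: (set2_eq uv E) => [] [-> ->] //; rewrite esym.
move=> uv; split; first by apply: contraTneq uv => ->; rewrite eirr.
by apply/existsP; exists u; apply/existsP; exists v; rewrite uv eqxx.
Qed.

(** Each end has the other as its only neighbour, so the pair is closed under adjacency. *)
Lemma isolated_edge_deg1 u v : e u v ->
  deg (edges e) u = 1 -> deg (edges e) v = 1 -> isolated_edge e [set u; v].
Proof.
move=> uv u1 v1; split.
  by rewrite inE; apply/existsP; exists u; apply/existsP; exists v; rewrite uv eqxx.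
have vN : v \in nbh (edges e) u by rewrite in_nbh adj_edges.
have uN : u \in nbh (edges e) v by rewrite nbhC.
have Nu := deg1_nbh u1 vN; have Nv := deg1_nbh v1 uN.
have cl : closed e (mem [set u; v]).
  apply: intro_closed => [|x y xy]; first exact/sym_connect_sym/(proj1 Hgraph).
  have : y \in nbh (edges e) x by rewrite in_nbh adj_edges.
  rewrite !inE => /[swap] /orP[] /eqP ->; rewrite -in_nbh ?Nu ?Nv inE => ->;
    by rewrite ?orbT.
exists u; apply/setP=> w; rewrite inE; apply/idP/idP.
  by move/(closed_connect cl) => <-; rewrite set21.
rewrite !inE => /orP[] /eqP ->; [exact: connect0 | exact: connect1].
Qed.

End SimpleGraph.

Theorem theorem15 (T : finType) (e : rel T) (m k : nat)
  (He : simple_graph e) (Hm : #|edges e| = m)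
  (Hiso : forall A : {set T}, ~ isolated_edge e A) (Hk : 0 < k) :
  exists f : {set T} -> nat,
    bij_onto_interval (edges e) k (m + k - 1) f /\
    forall v w : T, e v w -> vertex_sum e f v <> vertex_sum e f w.
Proof.
have Ep := pairs_edges He; case: m Hm => [|n] Hm.
  (* With no edges there is no default label; the interval is empty because [k] is positive. *)
  have no A : A \in edges e -> False by rewrite (cards0_eq Hm) inE.
  exists (fun=> k); split; last first.
    by move=> v w; rewrite -(adj_edges He) => /andP[_ /no].
  by split=> [A /no|A B /no|i] //; lia.
(* Ordinals shifted by [k] stand for the interval; [0 < k] makes all labels positive. *)
pose ev (i : 'I_n.+1) := k + i.
have ev_inj : injective ev by move=> i j /addnI/val_inj.
have [||v|f [finj _] fsep] := @weighted_labelling T _ ev ord0 ev_inj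
  #|edges e|.+1 (edges e) (fun=> 0) setT (ltnSn _) Ep.
- by rewrite cardsT card_ord.
- by move=> i _; rewrite /ev ltn_addr.
(* With zero weights no centre lies strictly below its leaves, so a violation is an isolated
   edge. *)
- apply/negP=> V; have v0 : 0 < deg (edges e) v by case/and4P: V.
  have [u uv] := card_gt0P v0; have u1 := viol_leaf V uv.
  have v1 : deg (edges e) v = 1.
    by apply/eqP; case/and4P: V => _ _ /forall_inP/(_ u uv); case: ifP.
  apply: (Hiso [set v; u]); apply: isolated_edge_deg1 => //.
  by rewrite -(adj_edges He) -in_nbh.
have fsum v : vertex_sum e (ev \o f) v = wsum ev (edges e) (fun=> 0) f v.
  by rewrite /vertex_sum /wsum sum_incident.
exists (ev \o f); split; last first.
  by move=> v w; rewrite -(adj_edges He) => /fsep/eqP; rewrite !fsum.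
split=> [A _|A B AE BE /ev_inj|i /andP[ki im]].
- by rewrite /= /ev; have := ltn_ord (f A); lia.
- exact: finj.
have im' : i - k < n.+1 by lia.
have : Ordinal im' \in f @: edges e.
  suff -> : f @: edges e = setT by rewrite inE.
  apply/eqP; rewrite eqEcard subsetT cardsT card_ord card_in_imset //=.
  exact: eq_leq (esym Hm).
by case/imsetP=> A AE fA; exists A => //=; rewrite /ev -fA /=; lia.
Qed.
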